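(* Let $\tau>0$, let $\{t_l\}_{l=1}^n$ be real numbers with $t_1\ge 2\tau$ and $t_{l+1}\ge t_l+4\tau$ for all $l\in\{1,\dots,n-1\}$, and let $T:=t_n+2\tau$. Consider the memristive crossbar array with all switches closed ($S=I$), and define $P:[0,T]\to\mathbb{R}^{n+m}$, $P=(P_1^A,\dots,P_n^A,P_1^B,\dots,P_m^B)^\top$, by $P_k^B(t)=0$ for all $t\in[0,T]$ and $k\in\{1,\dots,m\}$, and, for each $l\in\{1,\dots,n\}$, $$P_l^A(t)=\begin{cases}0 & t\in[0,t_l-2\tau)\\ -1 & t\in[t_l-2\tau,t_l-\tau)\\ 1 & t\in[t_l-\tau,t_l+\tau)\\ -1 & t\in[t_l+\tau,t_l+2\tau)\\ 0 & t\in[t_l+2\tau,T].\end{cases}$$ Then for any $\varphi_0\in\mathbb{R}^{mn}$, the set of consistent memductance matrices $\mathcal{W}(P,J_{\varphi_0,P})$ is a singleton and $\varphi_{\varphi_0,P}(T)=\varphi_0$.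
   Context: Fix positive integers $m,n$. For $k\in\{1,\dots,m\}$, $l\in\{1,\dots,n\}$ the memristor $M_{kl}$ is described by a function $g_{kl}:\mathbb{R}\to\mathbb{R}$ that is continuously differentiable and strictly monotone, i.e. $(g_{kl}(\varphi)-g_{kl}(\varphi'))(\varphi-\varphi')>0$ for all $\varphi\ne\varphi'$. Its memductance is $W_{kl}(\varphi)=\frac{dg_{kl}}{d\varphi}(\varphi)$. It is assumed that $W_{kl}$ is strictly monotone, i.e. $(W_{kl}(\varphi)-W_{kl}(\varphi'))(\varphi-\varphi')>0$ for all $\varphi\neq\varphi'$, and $\beta$-Lipschitz continuous for some $\beta>0$. Vectors in $\mathbb{R}^{mn}$ are indexed by pairs $(k,l)$, the entry $\varphi_{kl}$ being in position $k+m(l-1)$. Put $W(\varphi)=\mathrm{diag}(W_{11}(\varphi_{11}),W_{21}(\varphi_{21}),\dots,W_{m1}(\varphi_{m1}),W_{12}(\varphi_{12}),\dots,W_{mn}(\varphi_{mn}))\in\mathbb{R}^{mn\times mn}$. The incidence matrix is $$D=\begin{bmatrix} I_n\otimes \mathbf{1}_m^\top\\ -\mathbf{1}_n^\top\otimes I_m\end{bmatrix}\in\mathbb{R}^{(n+m)\times mn},$$ with $\mathbf{1}_r$ the all-ones column vector of size $r$ and $\otimes$ the Kronecker product. With all switches closed, the crossbar array dynamics are $$\tfrac{d}{dt}\varphi=D^\top P,\qquad J=D\,W(\varphi)\,D^\top P,$$ where $\varphi(t)\in\mathbb{R}^{mn}$ is the vector of fluxes, $P=(P_1^A,\dots,P_n^A,P_1^B,\dots,P_m^B)^\top$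 the terminal voltage potentials and $J=(J_1^A,\dots,J_n^A,J_1^B,\dots,J_m^B)^\top$ the terminal currents. For piecewise continuous $P$, the differential equation is understood in integral form, $\varphi(t)=\varphi(0)+\int_0^t D^\top P(s)\,ds$, and the equation for $J$ holds for all $t\in[0,T]$. For given $P$ and initial condition $\varphi(0)=\varphi_0$, the resulting flux trajectory and current are denoted $\varphi_{\varphi_0,P}$ and $J_{\varphi_0,P}$. For $P,J:[0,T]\to\mathbb{R}^{n+m}$, the set of consistent memductance matrices $\mathcal{W}(P,J)$ is the set of all $W\in\mathbb{R}^{mn\times mn}$ for which there exists $\varphi:[0,T]\to\mathbb{R}^{mn}$ such that $(P,\varphi,J)$ satisfy $\varphi(t)=\varphi(0)+\int_0^t D^\top P(s)\,ds$ and $J(t)=D\,W(\varphi(t))\,D^\top P(t)$ for all $t\in[0,T]$, and $W(\varphi(0))=W$. *)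

(* Defs.v *)
From HB Require Import structures.
From mathcomp Require Import all_boot all_order all_algebra.
From mathcomp Require Import all_classical all_reals all_analysis.
From mathcomp Require Import mxtens.

Set Implicit Arguments.
Unset Strict Implicit.
Unset Printing Implicit Defensive.

Import Order.TTheory GRing.Theory Num.Theory.
Import numFieldNormedType.Exports.

Local Open Scope classical_set_scope.
Local Open Scope ring_scope.

Definition strictly_monotone (R : realType) (f : R -> R) : Prop :=
  forall x y : R, x != y -> 0 < (f x - f y) * (x - y).

Definition memristor (R : realType) (beta : R) (g : R -> R) : Prop :=
  [/\ forall x : R, derivable g x 1,
      continuous (derive1 g),
      strictly_monotone g,
      strictly_monotone (derive1 g) &
      beta.-lipschitz (derive1 g)].

(* The casts only identify n * 1 with n and 1 * m with m.  The columns are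
   indexed by 'I_(n * m) with the indexing of the Kronecker product: the pair
   (k, l), with k : 'I_m and l : 'I_n, sits in column mxtens_index (l, k),
   whose value is l * m + k (both indices starting from 0). *)
Definition incidence (R : realType) (m n : nat) : 'M[R]_(n + m, n * m) :=
  col_mx
    (castmx (muln1 n, erefl (n * m)%N)
       ((1%:M : 'M[R]_n) *t (const_mx 1 : 'rV[R]_m)))
    (castmx (mul1n m, erefl (n * m)%N)
       ((- const_mx 1 : 'rV[R]_n) *t (1%:M : 'M[R]_m))).

Definition memductance_mx (R : realType) (m n : nat)
    (g : 'I_m -> 'I_n -> R -> R) (phi : 'cV[R]_(n * m)) : 'M[R]_(n * m) :=
  diag_mx (\row_p
    derive1 (g (mxtens_unindex p).2 (mxtens_unindex p).1) (phi p 0)).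

Definition int_col (R : realType) (d : nat) (a b : R) (v : R -> 'cV[R]_d) :
    'cV[R]_d :=
  \col_i \int[lebesgue_measure]_(s in `[a, b]) v s i 0.

(* Trajectories on [0, T] are total functions on R of which only the values on
   [0, T] matter.  The first conjunct makes the integrals below meaningful; it
   holds for every piecewise continuous P. *)
Definition crossbar_trajectory (R : realType) (m n : nat)
    (g : 'I_m -> 'I_n -> R -> R) (T : R)
    (P : R -> 'cV[R]_(n + m)) (phi : R -> 'cV[R]_(n * m))
    (J : R -> 'cV[R]_(n + m)) : Prop :=
  let D := incidence R m n in
  [/\ forall p, lebesgue_measure.-integrable `[0, T]
        (EFin \o (fun s : R => (D^T *m P s) p 0)),
      forall t : R, t \in `[0, T] ->
        phi t = phi 0 + int_col 0 t (fun s => D^T *m P s) &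
      forall t : R, t \in `[0, T] ->
        J t = D *m memductance_mx g (phi t) *m D^T *m P t].

Definition consistent_memductances (R : realType) (m n : nat)
    (g : 'I_m -> 'I_n -> R -> R) (T : R) (P J : R -> 'cV[R]_(n + m)) :
    set 'M[R]_(n * m) :=
  [set W | exists2 phi : R -> 'cV[R]_(n * m),
     crossbar_trajectory g T P phi J & memductance_mx g (phi 0) = W].

(* The right-hand side D^T P of the flux equation does not depend on the flux,
   so the solution is explicit. *)
Definition flux (R : realType) (m n : nat) (phi0 : 'cV[R]_(n * m))
    (P : R -> 'cV[R]_(n + m)) (t : R) : 'cV[R]_(n * m) :=
  phi0 + int_col 0 t (fun s => (incidence R m n)^T *m P s).

Definition current (R : realType) (m n : nat) (g : 'I_m -> 'I_n -> R -> R)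
    (phi0 : 'cV[R]_(n * m)) (P : R -> 'cV[R]_(n + m)) (t : R) :
    'cV[R]_(n + m) :=
  let D := incidence R m n in
  D *m memductance_mx g (flux phi0 P t) *m D^T *m P t.

Definition read_pulse (R : realType) (tau c s : R) : R :=
  if s \in `[c - 2 * tau, c - tau[ then -1
  else if s \in `[c - tau, c + tau[ then 1
  else if s \in `[c + tau, c + 2 * tau[ then -1
  else 0.

(* tl is indexed from 1 as in t_1, ..., t_n, whereas l : 'I_n starts from 0. *)
Definition read_voltage (R : realType) (m n : nat) (tau : R) (tl : nat -> R)
    (s : R) : 'cV[R]_(n + m) :=
  col_mx (\col_(l < n) read_pulse tau (tl l.+1) s) (0 : 'cV[R]_m).

(* Main.v *)
(* At time t_l - 2 tau only the terminal P_l^A is under voltage (equal to -1),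
   and the fluxes of column l have not moved yet, so the k-th current J^B_k is
   W_kl(phi_kl(0)): the current determines W(phi(0)).  The flux returns to its
   initial value because every pulse has zero mean. *)
Require Import Defs.
From mathcomp Require Import all_boot all_order all_algebra.
From mathcomp Require Import all_classical all_reals all_analysis.
From mathcomp Require Import mxtens lra.

Set Implicit Arguments.
Unset Strict Implicit.
Unset Printing Implicit Defensive.

Import Order.TTheory GRing.Theory Num.Theory.
Import numFieldNormedType.Exports.

Local Open Scope classical_set_scope.
Local Open Scope ring_scope.

Lemma incidence_lshift (R : realType) (m n : nat) (l : 'I_n) (p : 'I_(n * m)) :
  incidence R m n (lshift m l) p = (l == (mxtens_unindex p).1)%:R.
Proof.
rewrite /incidence col_mxEu castmxE cast_ord_id mxE !mxE mulr1.
(* A row of the first Kronecker product is split by division by 1, the number of rows of its second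
   factor; for the lower block the split is by remainder modulo [m]. *)
by congr (_ == _)%:R; apply: val_inj; rewrite /= divn1.
Qed.

Lemma incidence_rshift (R : realType) (m n : nat) (k : 'I_m) (p : 'I_(n * m)) :
  incidence R m n (rshift n k) p = - (k == (mxtens_unindex p).2)%:R.
Proof.
rewrite /incidence col_mxEd castmxE cast_ord_id mxE !mxE mulN1r.
by congr (- (_ == _)%:R); apply: val_inj; rewrite /= modn_small.
Qed.

(** Memristor (k, l) sees the voltage P_l^A - P_k^B, and all P_k^B vanish here. *)
Lemma incidence_read_voltage (R : realType) (m n : nat) (tau : R)
    (tl : nat -> R) (s : R) (p : 'I_(n * m)) :
  ((incidence R m n)^T *m read_voltage m n tau tl s) p 0 =
  read_pulse tau (tl (mxtens_unindex p).1.+1) s.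
Proof.
rewrite mxE big_split_ord /= [X in _ + X]big1 ?addr0 => [|k _]; last first.
  by rewrite /read_voltage col_mxEd [(0 : matrix _ _ _) _ _]mxE mulr0.
rewrite (bigD1 (mxtens_unindex p).1) //= big1 ?addr0 => [|l lp].
  by rewrite mxE incidence_lshift eqxx mul1r /read_voltage col_mxEu mxE.
by rewrite mxE incidence_lshift (negbTE lp) mul0r.
Qed.

(** The three windows are disjoint, so the nested conditionals become a linear combination;
    integrability and integrals then follow by linearity. *)
Lemma read_pulse_indic (R : realType) (tau c : R) : 0 < tau ->
  read_pulse tau c = \1_(`[c - tau, c + tau[) -
    (\1_(`[c - 2 * tau, c - tau[) + \1_(`[c + tau, c + 2 * tau[)).
Proof.
move=> tau0; apply/funext => s.
rewrite /read_pulse /= !fctE !indicE !mem_setE !in_itv /=.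
have [? | ?] := leP (c - 2 * tau) s; have [? | ?] := ltP s (c - tau);
have [? | ?] := ltP s (c + tau); have [? | ?] := ltP s (c + 2 * tau) => //=; lra.
Qed.

Lemma integrable_read_pulse (R : realType) (tau c : R) (D : set R) :
  0 < tau -> measurable D ->
  lebesgue_measure.-integrable D (EFin \o read_pulse tau c).
Proof.
move=> tau0 mD; rewrite (read_pulse_indic _ tau0).
apply: (@integrableS _ _ _ _ setT) => //.
apply: (@integrableB _ _ _ lebesgue_measure setT measurableT
  (EFin \o \1__) (EFin \o (\1__ + \1__))); first exact: integrable_indic_itv.
by apply: (@integrableD _ _ _ lebesgue_measure setT measurableT
  (EFin \o \1__) (EFin \o \1__)); exact: integrable_indic_itv.
Qed.

Lemma Rintegral_indic_itvco (R : realType) (T a b : R) :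
  0 <= a -> a <= b -> b <= T ->
  \int[lebesgue_measure]_(s in `[0, T]) (\1_(`[a, b[) s) = b - a.
Proof.
move=> a0 ab bT; rewrite /Rintegral integral_indic//.
rewrite setIidl => [|s /=]; last by rewrite !in_itv /= => /andP[? ?]; lra.
(* The length formula tests [a < b]; otherwise [a = b] and both sides are 0. *)
rewrite [X in fine X]lebesgue_measure_itv /= lte_fin; case: ltP => //= ba; lra.
Qed.

(** The positive window has length [2 * tau], each negative one length [tau], and the bounds on [c]
    keep all three inside [[0, T]]. *)
Lemma Rintegral_read_pulse_eq0 (R : realType) (tau c T : R) :
  0 < tau -> 2 * tau <= c -> c + 2 * tau <= T ->
  \int[lebesgue_measure]_(s in `[0, T]) read_pulse tau c s = 0.
Proof.
move=> tau0 ctau cT; rewrite (read_pulse_indic _ tau0).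
have I a b : lebesgue_measure.-integrable `[0, T] (EFin \o \1_(`[a, b[ : set R)).
  by apply: (@integrableS _ _ _ _ setT) => //; exact: integrable_indic_itv.
rewrite RintegralB//; last first.
  exact: (@integrableD _ _ _ lebesgue_measure _ _ (EFin \o \1__) (EFin \o \1__)).
rewrite RintegralD// !Rintegral_indic_itvco; lra.
Qed.

Lemma Rintegral_read_pulse_before (R : realType) (tau c : R) : 0 < tau ->
  \int[lebesgue_measure]_(s in `[0, c - 2 * tau]) read_pulse tau c s = 0.
Proof.
(* At the right endpoint the pulse is already -1; dropping this null set leaves an integrand equal
   to 0. *)
move=> tau0; rewrite -Rintegral_itv_bndo_bndc; last exact: integrable_read_pulse.
rewrite (@eq_Rintegral _ _ _ _ _ (cst 0)) ?Rintegral_cst ?mul0r// => s.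
rewrite inE /= in_itv /= => /andP[_ sc]; rewrite /read_pulse !in_itv /=.
by do 3![case: ifP => [/andP[? ?]|_]; first lra].
Qed.

Lemma read_pulse_start (R : realType) (tau c : R) : 0 < tau ->
  read_pulse tau c (c - 2 * tau) = -1.
Proof. by move=> tau0; rewrite /read_pulse !in_itv /= lexx ifT//=; lra. Qed.

Lemma read_pulse_outside (R : realType) (tau c s : R) : 0 < tau ->
  (s < c - 2 * tau) || (c + 2 * tau <= s) -> read_pulse tau c s = 0.
Proof.
move=> tau0 cs; rewrite /read_pulse !in_itv /=.
by case/orP: cs => ?; do 3![case: ifP => [/andP[? ?]|_]; first lra].
Qed.

Lemma int_col_incidence_read_voltage (R : realType) (m n : nat) (tau a b : R)
    (tl : nat -> R) (p : 'I_(n * m)) :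
  int_col a b (fun s => (incidence R m n)^T *m read_voltage m n tau tl s) p 0 =
  \int[lebesgue_measure]_(s in `[a, b])
    read_pulse tau (tl (mxtens_unindex p).1.+1) s.
Proof.
by rewrite mxE; apply: eq_Rintegral => s _; rewrite incidence_read_voltage.
Qed.

(** Row B_k of the incidence matrix meets only the memristors (k, .), and the voltage only those of
    column [l], so a single term survives; its sign is that of the lower incidence block. *)
Lemma current_rshift (R : realType) (m n : nat) (g : 'I_m -> 'I_n -> R -> R)
    (phi : 'cV[R]_(n * m)) (P : 'cV[R]_(n + m)) (k : 'I_m) (l : 'I_n) :
  (forall p : 'I_(n * m), (mxtens_unindex p).1 != l ->
     ((incidence R m n)^T *m P) p 0 = 0) ->
  (incidence R m n *m memductance_mx g phi *m (incidence R m n)^T *m P)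
    (rshift n k) 0 =
  - (derive1 (g k l) (phi (mxtens_index (l, k)) 0) *
     ((incidence R m n)^T *m P) (mxtens_index (l, k)) 0).
Proof.
move=> Pl; rewrite -mulmxA mxE (bigD1 (mxtens_index (l, k))) //= big1.
  rewrite addr0 mul_mx_diag [X in X * _]mxE incidence_rshift mxtens_indexK eqxx.
  by rewrite mulN1r mulNr [X in X * _]mxE mxtens_indexK.
move=> p pkl; have [pl | /Pl ->] := eqVneq (mxtens_unindex p).1 l; last first.
  by rewrite mulr0.
rewrite mul_mx_diag [X in X * _]mxE incidence_rshift; case: eqVneq => [pk|_].
  by rewrite -(mxtens_unindexK p) -pl pk -surjective_pairing eqxx in pkl.
by rewrite oppr0 !mul0r.
Qed.

Lemma read_times_spacing (R : realType) (n : nat) (tau : R) (tl : nat -> R)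
    (i j : nat) : 0 < tau ->
  (forall l : nat, (1 <= l < n)%N -> tl l + 4 * tau <= tl l.+1) ->
  (1 <= i)%N -> (i < j <= n)%N -> tl i + 4 * tau <= tl j.
Proof.
move=> tau0 tlS i1 /andP[]; elim: j => // j IH.
rewrite ltnS leq_eqVlt => /predU1P[<- jn|ij jn]; first by apply: tlS; rewrite i1.
have tij := IH ij (ltnW jn).
have tj : tl j + 4 * tau <= tl j.+1.
  by apply: tlS; rewrite jn (leq_trans i1 (ltnW ij)).
lra.
Qed.

Lemma read_times_bounds (R : realType) (n : nat) (tau : R) (tl : nat -> R)
    (l : 'I_n) : 0 < tau -> 2 * tau <= tl 1%N ->
  (forall l : nat, (1 <= l < n)%N -> tl l + 4 * tau <= tl l.+1) ->
  2 * tau <= tl l.+1 <= tl n.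
Proof.
move=> tau0 tl1 tlS; apply/andP; split.
  case: l => -[//|l] /= ln.
  by have := read_times_spacing tau0 tlS (leqnn 1) (j := l.+2) ln => ?; lra.
have := ltn_ord l; rewrite leq_eqVlt => /predU1P[->//|ln].
have := @read_times_spacing _ _ _ _ l.+1 n tau0 tlS isT.
by rewrite ln leqnn => /(_ isT) ?; lra.
Qed.

(** Supports have length [4 * tau], the minimal spacing. An earlier pulse may end exactly when the
    next one starts, but being half-open it is already 0 there. *)
Lemma read_pulse_disjoint (R : realType) (n : nat) (tau : R) (tl : nat -> R)
    (l l' : 'I_n) : 0 < tau ->
  (forall l : nat, (1 <= l < n)%N -> tl l + 4 * tau <= tl l.+1) ->
  l' != l -> read_pulse tau (tl l'.+1) (tl l.+1 - 2 * tau) = 0.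
Proof.
move=> tau0 tlS ll'; apply: read_pulse_outside => //.
case: (ltngtP l' l) => [lt|gt|/val_inj e]; last by rewrite e eqxx in ll'.
  have := @read_times_spacing _ _ _ _ l'.+1 l.+1 tau0 tlS isT.
  by rewrite ltnS lt ltn_ord => /(_ isT) ?; apply/orP; right; lra.
have := @read_times_spacing _ _ _ _ l.+1 l'.+1 tau0 tlS isT.
by rewrite ltnS gt ltn_ord => /(_ isT) ?; apply/orP; left; lra.
Qed.

(** Here [phi] is any trajectory consistent with [J], and the right-hand side depends on [J] alone;
    this yields uniqueness. *)
Lemma trajectory_memductance (R : realType) (m n : nat)
    (g : 'I_m -> 'I_n -> R -> R) (tau : R) (tl : nat -> R)
    (phi : R -> 'cV[R]_(n * m)) (J : R -> 'cV[R]_(n + m)) (p : 'I_(n * m)) :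
  0 < tau -> 2 * tau <= tl 1%N ->
  (forall l : nat, (1 <= l < n)%N -> tl l + 4 * tau <= tl l.+1) ->
  crossbar_trajectory g (tl n + 2 * tau) (read_voltage m n tau tl) phi J ->
  derive1 (g (mxtens_unindex p).2 (mxtens_unindex p).1) (phi 0 p 0) =
  J (tl (mxtens_unindex p).1.+1 - 2 * tau) (rshift n (mxtens_unindex p).2) 0.
Proof.
move=> tau0 tl1 tlS [_ phiE JE].
have pE : mxtens_index ((mxtens_unindex p).1, (mxtens_unindex p).2) = p.
  by rewrite -surjective_pairing mxtens_unindexK.
have /andP[l0 lT] := read_times_bounds (mxtens_unindex p).1 tau0 tl1 tlS.
have tT : tl (mxtens_unindex p).1.+1 - 2 * tau \in `[0, tl n + 2 * tau].
  by rewrite in_itv /=; lra.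
rewrite JE// (@current_rshift _ _ _ g _ _ _ (mxtens_unindex p).1); last first.
  by move=> q ql; rewrite incidence_read_voltage (read_pulse_disjoint tau0 tlS).
(* The pulse value -1 cancels the sign of the lower incidence block. *)
rewrite pE incidence_read_voltage read_pulse_start// mulrN1 opprK.
rewrite (phiE _ tT) mxE int_col_incidence_read_voltage.
by rewrite Rintegral_read_pulse_before// addr0.
Qed.

Lemma flux_trajectory (R : realType) (m n : nat) (g : 'I_m -> 'I_n -> R -> R)
    (tau T : R) (tl : nat -> R) (phi0 : 'cV[R]_(n * m)) :
  0 < tau ->
  let P := read_voltage m n tau tl in
  crossbar_trajectory g T P (flux phi0 P) (current g phi0 P).
Proof.
move=> tau0 P; split=> [p|t _|//].
  rewrite (_ : _ \o _ = EFin \o read_pulse tau (tl (mxtens_unindex p).1.+1)).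
    exact: integrable_read_pulse.
  by apply/funext => s /=; rewrite incidence_read_voltage.
(* A trajectory is stated from its own value at time 0, which for [flux] is [phi0] because an
   integral over one point vanishes. *)
rewrite /flux (_ : int_col 0 0 _ = 0) ?addr0//.
by apply/colP => p; rewrite !mxE set_itv1 Rintegral_set1.
Qed.

Theorem theorem1 (R : realType) (m n : nat) (hm : (0 < m)%N) (hn : (0 < n)%N)
    (g : 'I_m -> 'I_n -> R -> R) (beta : R) (hbeta : 0 < beta)
    (hg : forall (k : 'I_m) (l : 'I_n), memristor beta (g k l))
    (tau : R) (htau : 0 < tau) (tl : nat -> R)
    (htl1 : 2 * tau <= tl 1%N)
    (htl : forall l : nat, (1 <= l < n)%N ->
       tl l + 4 * tau <= tl l.+1)
    (phi0 : 'cV[R]_(n * m)) :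
  let T := tl n + 2 * tau in
  let P := read_voltage m n tau tl in
  (exists W0 : 'M[R]_(n * m),
     consistent_memductances g T P (current g phi0 P) = [set W0]) /\
  flux phi0 P T = phi0.
Proof.
move=> T P; split; last first.
  apply/colP => p; rewrite mxE int_col_incidence_read_voltage.
  have /andP[l0 lT] := read_times_bounds (mxtens_unindex p).1 htau htl1 htl.
  by rewrite Rintegral_read_pulse_eq0 ?addr0 // lerD2r.
have flux_traj : crossbar_trajectory g T P (flux phi0 P) (current g phi0 P).
  exact: flux_trajectory.
exists (memductance_mx g (flux phi0 P 0)); apply/seteqP; split=> W /=; last first.
  by move=> ->; exists (flux phi0 P).
case=> phi traj <-; congr diag_mx; apply/rowP => p.
(* Both diagonal entries are read off the same entry of the same current. *)
rewrite [LHS]mxE [RHS]mxE (trajectory_memductance _ htau htl1 htl traj).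
by rewrite (trajectory_memductance _ htau htl1 htl flux_traj).
Qed.
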